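(* There exists a universal constant $C>0$ such that for every outcome-based bandit with $K$ arms and $m$ outcomes (with arbitrary, possibly imbalanced, class sizes) satisfying the strong generalization assumption, and every horizon $T\ge 2$, the Partition-Aware UCB algorithm (strong generalization and the algorithm are defined in the context) has expected pseudo-regret $$\mathbb{E}[R_T]\ \le\ C\sqrt{m\,T\log T}.$$
   Context: Outcome-based bandit. There is a set of arms $\mathcal{A}$ with $|\mathcal{A}|=K$, a set of outcomes $\mathcal{O}=\{1,\dots,m\}$, and a mapping $\phi:\mathcal{A}\to\mathcal{O}$ unknown to the learner, with classes $\mathcal{A}_o=\phi^{-1}(o)$ whose sizes sum to $K$. The learner knows $\mathcal{A}$ and $m$. Rewards depend only on the outcome: pulling arm $a$ yields a random reward in $[0,1]$ with mean $\mu(\phi(a))$, where the reward minus its mean is $1$-sub-Gaussian. At each round $t=1,\dots,T$ the algorithm selects an arm $A_t\in\mathcal{A}$ based on the information available to it, then observes the outcome $O_t=\phi(A_t)$ and a reward $R_t$ with mean $\mu(O_t)$. With $\mu^\star=\max_o\mu(o)$, the expected pseudo-regret is $\mathbb{E}[R_T]=\sum_{t=1}^T\mathbb{E}[\mu^\star-\mu(O_t)]$. Strong generalization assumption. When the learner pulls an arm $a$ and observes $o=\phi(a)$, from then on it knows the entire class $\mathcal{A}_o=\phi^{-1}(o)$, and can (i) route to $o$ by selecting any arm in $\mathcal{A}_o$ and (ii) exclude $\mathcal{A}_o$ from future fresh probes. For any outcome $o$ not yet observed, the learner can neither route to $\mathcal{A}_o$ nor exclude it a priori. Partition-Aware UCB.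 Maintain a set $\mathcal{R}$ of discovered outcomes (initially empty), a representative arm $\mathrm{rep}[o]$ for each discovered $o$, counts $n_o$ and empirical means $\hat\mu_o$ (initially $0$), and a pool $U$ of arms eligible for fresh probes (initially $U=\mathcal{A}$). At each round $t$: - If $|\mathcal{R}|<m$ (discovery): pick any $A_t\in U$, pull it, and observe $o=\phi(A_t)$ and reward $r_t$. If $o\notin\mathcal{R}$, add $o$ to $\mathcal{R}$, set $\mathrm{rep}[o]=A_t$, $n_o=1$, $\hat\mu_o=r_t$, and replace $U$ by $U\setminus\mathcal{A}_o$. Otherwise update $n_o\leftarrow n_o+1$ and $\hat\mu_o\leftarrow\hat\mu_o+(r_t-\hat\mu_o)/n_o$. - If $|\mathcal{R}|=m$: choose $o_t\in\arg\max_{o\in\mathcal{R}}\left(\hat\mu_o+\sqrt{2\log t/\max\{1,n_o\}}\right)$, pull $\mathrm{rep}[o_t]$, observe $r_t$, and update $n_{o_t}\leftarrow n_{o_t}+1$ and $\hat\mu_{o_t}\leftarrow\hat\mu_{o_t}+(r_t-\hat\mu_{o_t})/n_{o_t}$. Each outcome class $\mathcal{A}_o$, $o\in\mathcal{O}$, is nonempty. *)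

(* Defs.v *)
From HB Require Import structures.
From mathcomp Require Import all_boot all_order all_algebra.
From mathcomp Require Import all_classical all_reals all_analysis.

Set Implicit Arguments.
Unset Strict Implicit.
Unset Printing Implicit Defensive.

Import Order.TTheory GRing.Theory Num.Theory.
Import numFieldNormedType.Exports.

Local Open Scope classical_set_scope.
Local Open Scope ring_scope.

(* [E exp(l (X - mu)) <= exp(s^2 l^2 / 2)] for X of law [nu] and every l. *)
Definition sub_gaussian (R : realType) (nu : probability (measurableTypeR R) R)
    (mu s : R) : Prop :=
  forall l : R,
    (\int[nu]_x (expR (l * (x - mu)))%:E <= (expR (s ^+ 2 * l ^+ 2 / 2))%:E)%E.

(* Arms are 'I_K and outcomes 'I_m.  The reward law is indexed by the outcome:
   two arms with the same outcome have the same reward law. *)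
Record bandit (R : realType) (K m : nat) := Bandit {
  outcome : 'I_K -> 'I_m;
  mean_reward : 'I_m -> R;
  law : 'I_m -> probability (measurableTypeR R) R;
  outcome_surj : forall o : 'I_m, exists a : 'I_K, outcome a = o;
  law_unit : forall o, law o `[0%R : R, 1%R : R]%classic = 1%E;
  law_mean : forall o, (\int[law o]_x x%:E)%E = (mean_reward o)%:E;
  law_sub_gaussian : forall o, sub_gaussian (law o) (mean_reward o) 1
}.

Definition class_of (R : realType) (K m : nat) (B : bandit R K m) (o : 'I_m)
  : {set 'I_K} := [set a | outcome B a == o]%SET.

(* The default value 0 of the iterated maximum is harmless, means being
   nonnegative. *)
Definition best_mean (R : realType) (K m : nat) (B : bandit R K m) : R :=
  \big[Num.max/0]_(o < m) mean_reward B o.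

(* What one pull reveals under strong generalization: besides the arm, its
   outcome and the reward, the entire class of the outcome. *)
Record observation (R : realType) (K m : nat) := Observation {
  obs_arm : 'I_K;
  obs_outcome : 'I_m;
  obs_class : {set 'I_K};
  obs_reward : R
}.

Definition observe (R : realType) (K m : nat) (B : bandit R K m)
    (a : 'I_K) (r : R) : observation R K m :=
  Observation a (outcome B a) (class_of B (outcome B a)) r.

(* Rounds are numbered from 1: [A t], [X t] are the arm and the reward of round
   [t], and index 0 is unused. *)
Definition history (R : realType) (K m : nat) (B : bandit R K m)
    (Omega : Type) (A : nat -> Omega -> 'I_K) (X : nat -> Omega -> R)
    (t : nat) (w : Omega) : seq (observation R K m) :=
  [seq observe B (A s w) (X s w) | s <- iota 1 t].

Definition filtration d (Omega : measurableType d) (F : nat -> set (set Omega))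
  : Prop :=
  [/\ forall t, sigma_algebra [set: Omega] (F t),
      forall t, F t `<=` measurable
    & forall t, F t `<=` F t.+1].

(* [T] rounds of interaction between [B] and a learner [pick], which chooses
   each arm from its internal randomness (a seed of law [Q], drawn before the
   first round) and from the observations made so far; it has no other access
   to [B].  The last clause says that, conditionally on the past [F t] (which
   determines the arm of round t+1), the reward of round t+1 has the law
   attached to the outcome of the arm pulled. *)
Record interaction (R : realType) (K m : nat)
    dS (S : measurableType dS) (Q : probability S R)
    (pick : S -> seq (observation R K m) -> 'I_K)
    (B : bandit R K m) (T : nat)
    d (Omega : measurableType d) (P : probability Omega R)
    (F : nat -> set (set Omega)) (seed : Omega -> S)
    (A : nat -> Omega -> 'I_K) (X : nat -> Omega -> R) : Prop := Interaction {
  past_filtration : filtration F;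
  seed_past : forall E : set S, measurable E -> F 0%N (seed @^-1` E);
  seed_law : forall E : set S, measurable E -> P (seed @^-1` E) = Q E;
  arm_pick : forall t, (t < T)%N ->
    forall w, A t.+1 w = pick (seed w) (history B A X t w);
  arm_past : forall t, (t < T)%N -> forall a, F t (A t.+1 @^-1` [set a]);
  reward_past : forall t, (t < T)%N ->
    forall D : set (measurableTypeR R), measurable D ->
    F t.+1 (X t.+1 @^-1` D);
  reward_law : forall t, (t < T)%N ->
    forall (E : set Omega) (a : 'I_K) (D : set (measurableTypeR R)),
    F t E -> measurable D ->
    P (E `&` A t.+1 @^-1` [set a] `&` X t.+1 @^-1` D) =
    (P (E `&` A t.+1 @^-1` [set a]) * law B (outcome B a) D)%E
}.

Definition expected_regret (R : realType) (K m : nat) (B : bandit R K m)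
    d (Omega : measurableType d) (P : probability Omega R)
    (A : nat -> Omega -> 'I_K) (T : nat) : \bar R :=
  (\sum_(1 <= t < T.+1)
     'E_P[fun w => (best_mean B - mean_reward B (outcome B (A t w)))%R])%E.

Record ucb_state (R : realType) (K m : nat) := UcbState {
  discovered : {set 'I_m};
  rep : 'I_m -> option 'I_K;
  pulls : 'I_m -> nat;
  emp_mean : 'I_m -> R;
  pool : {set 'I_K}
}.

Definition init_state (R : realType) (K m : nat) : ucb_state R K m :=
  UcbState finset.set0 (fun=> None) (fun=> 0%N) (fun=> 0) [set: 'I_K]%SET.

Definition record_reward (R : realType) (K m : nat) (s : ucb_state R K m)
    (o : 'I_m) (r : R) : ucb_state R K m :=
  let n := (pulls s o).+1 in
  UcbState (discovered s) (rep s)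
    [eta pulls s with o |-> n]
    [eta emp_mean s with o |-> emp_mean s o + (r - emp_mean s o) / n%:R]
    (pool s).

Definition discover (R : realType) (K m : nat) (s : ucb_state R K m)
    (z : observation R K m) : ucb_state R K m :=
  let o := obs_outcome z in
  if o \in discovered s then record_reward s o (obs_reward z)
  else UcbState (o |: discovered s)%SET
         [eta rep s with o |-> Some (obs_arm z)]
         [eta pulls s with o |-> 1%N]
         [eta emp_mean s with o |-> obs_reward z]
         (pool s :\: obs_class z)%SET.

Definition ucb_index (R : realType) (K m : nat) (s : ucb_state R K m) (t : nat)
    (o : 'I_m) : R :=
  emp_mean s o + Num.sqrt (2 * ln t%:R / (maxn 1 (pulls s o))%:R).

(* Relational, since the fresh probe and the maximizer are arbitrary. *)
Inductive pa_ucb_step (R : realType) (K m : nat) (t : nat)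
    (s : ucb_state R K m) (z : observation R K m) : ucb_state R K m -> Prop :=
| StepDiscover :
    (#|discovered s| < m)%N -> obs_arm z \in pool s ->
    pa_ucb_step t s z (discover s z)
| StepExploit (o : 'I_m) :
    #|discovered s| = m -> o \in discovered s ->
    (forall o', o' \in discovered s -> ucb_index s t o' <= ucb_index s t o) ->
    rep s o = Some (obs_arm z) ->
    pa_ucb_step t s z (record_reward s o (obs_reward z)).

(* [st t w] is the state of the algorithm after round [t]. *)
Definition pa_ucb_run (R : realType) (K m : nat) (B : bandit R K m) (T : nat)
    (Omega : Type) (A : nat -> Omega -> 'I_K) (X : nat -> Omega -> R)
    (st : nat -> Omega -> ucb_state R K m) : Prop :=
  forall w : Omega, st 0%N w = init_state R K m /\
    forall t, (t < T)%N ->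
      pa_ucb_step t.+1 (st t w) (observe B (A t.+1 w) (X t.+1 w)) (st t.+1 w).

(* Main.v *)
(** The discovery phase lasts at most [m] rounds, since a fresh probe always
    reveals a new outcome.  Afterwards, as long as every empirical mean is within
    its bonus of the true mean, a pull of [o] costs at most twice the bonus of
    [o], hence at most [6 sqrt(2 log T)] times the increase of the potential
    [sum_o sqrt(N_o)], which never exceeds [sqrt(m T)].  For the deviations,
    rewards in [0,1] have variance proxy 1/4 by Hoeffding's lemma, so the
    exponential weights of a fixed outcome form a supermartingale with mean at
    most 1; a union bound over outcomes, signs and pull counts leaves a total
    contribution of [2 m].  Finally [m <= sqrt(m T)] unless [T < m], in which
    case the trivial bound [T] suffices. *)

Require Import Defs.
From HB Require Import structures.
From mathcomp Require Import all_boot all_order all_algebra.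
From mathcomp Require Import all_classical all_reals all_analysis.
From mathcomp Require Import ring lra measurable_realfun giry.

Set Implicit Arguments.
Unset Strict Implicit.
Unset Printing Implicit Defensive.

Import Order.TTheory GRing.Theory Num.Theory.
Import numFieldNormedType.Exports.

Local Open Scope classical_set_scope.
Local Open Scope ring_scope.

(** * Hoeffding's lemma for laws on the unit interval *)

Lemma is_derive_ge0_homo (R : realType) (f df : R -> R) (x : R) :
  (forall y, is_derive (y : R) 1 f (df y)) -> (forall y, 0 < y -> 0 <= df y) ->
  0 <= x -> f 0 <= f x.
Proof.
move=> fdf df0 x0.
apply: (@ger0_derive1_ndecry R f 0) => //.
- by move=> y; rewrite in_itv /= andbT => y0; rewrite derive1E derive_val df0.
- by apply: derivable_within_continuous => y _; exact: ex_derive.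
Qed.

(** [D] is the moment generating function of the Bernoulli law of mean [p]. The difference [g] of
    the logarithms of the two sides vanishes at 0 together with its derivative [k], and [k] is
    nondecreasing on the positive half-line, so monotonicity applied twice gives the bound. *)
Lemma bernoulli_mgf_le_pos (R : realType) (p l : R) :
  0 <= p <= 1 -> 0 <= l -> 1 - p + p * expR l <= expR (l ^+ 2 / 8 + l * p).
Proof.
move=> /andP[p0 p1] l0.
pose D x : R := 1 - p + p * expR x.
have D0 x : 0 < D x.
  rewrite /D; have := expR_gt0 x.
  have [->|pn0] := eqVneq p 0; first by lra.
  have : 0 < p by rewrite lt_neqAle eq_sym pn0.
  by move=> ? ?; rewrite ltr_wpDl ?subr_ge0// mulr_gt0.
have dD x : is_derive x (1 : R) D (p * expR x).
  by apply: is_derive_eq; rewrite add0r mul1r.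
(* The derivative of [g] below, with p e^x / D x rewritten as 1 - (1 - p) / D x. *)
pose k x : R := x / 4 + p - 1 + (1 - p) * (D x)^-1.
have dk x : is_derive x (1 : R) k (4^-1 - (1 - p) * p * expR x * (D x) ^- 2).
  have := is_deriveV (lt0r_neq0 (D0 x)) => dV.
  apply: is_derive_eq.
  rewrite /GRing.scale /= mulr1; ring.
have k0 x : 0 < x -> 0 <= k x.
  move=> x0; have <- : k 0 = 0.
    by rewrite /k /D expR0 mulr1 subrK invr1; lra.
  apply: is_derive_ge0_homo (ltW x0) => // y _.
  rewrite subr_ge0 ler_pdivrMr ?exprn_gt0// -subr_ge0.
  (* Arithmetic-geometric mean: (a + b)^2 / 4 - a b = ((a - b) / 2)^2 with a = 1 - p and b = p
     e^y. *)
  rewrite (_ : _ - _ = (2^-1 * (1 - p - p * expR y)) ^+ 2) ?sqr_ge0//.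
  by rewrite /D; field.
pose g x : R := x ^+ 2 / 8 + x * p - ln (D x).
have dg x : is_derive x (1 : R) g (k x).
  have dln := is_derive1_ln (D0 x).
  have dc : is_derive x (1 : R) (@ln R \o D) ((D x)^-1 * (p * expR x)).
    by apply: is_derive1_comp.
  apply: is_derive_eq.
  rewrite /GRing.scale /= /k; have := lt0r_neq0 (D0 x); rewrite /D => ?.
  by field.
have : 0 <= g l.
  have <- : g 0 = 0 by rewrite /g /D expR0 mulr1 subrK ln1; lra.
  by apply: is_derive_ge0_homo l0.
by rewrite /g subr_ge0 -ler_expR lnK// posrE.
Qed.

(** For negative [l], swap the two values of the Bernoulli variable: apply the nonnegative case to 1
    - p and - l, then multiply by e^l. *)
Lemma bernoulli_mgf_le (R : realType) (p l : R) :
  0 <= p <= 1 -> 1 - p + p * expR l <= expR (l ^+ 2 / 8 + l * p).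
Proof.
move=> p01; have [l0|l0] := leP 0 l; first exact: bernoulli_mgf_le_pos.
have q01 : 0 <= 1 - p <= 1 by move: p01 => /andP[? ?]; apply/andP; split; lra.
have := bernoulli_mgf_le_pos q01 (_ : 0 <= - l).
rewrite oppr_ge0 => /(_ (ltW l0)).
rewrite -(ler_pM2r (expR_gt0 l)) mulrDl -mulrA -!expRD addNr expR0 mulr1.
rewrite (_ : 1 - (1 - p) = p); last by ring.
rewrite (_ : _ / _ + _ + l = l ^+ 2 / 8 + l * p); last by field.
by rewrite addrC.
Qed.

Lemma expR_chord (R : realType) (l x : R) :
  0 <= x <= 1 -> expR (l * x) <= 1 + (expR l - 1) * x.
Proof.
move=> /andP[x0 x1].
have := convex_expR (Itv01 x0 x1) l 0.
rewrite !convRE /= expR0 mulr0 addr0 mulr1 (mulrC x l) => /le_trans; apply.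
by rewrite /unstable.onem le_eqVlt; apply/orP; left; apply/eqP; ring.
Qed.

Section unit_interval_law.
Context (R : realType) (nu : probability (measurableTypeR R) R) (mu : R).
Hypothesis nu01 : nu `[0%R : R, 1%R : R]%classic = 1%E.
Hypothesis nu_mean : (\int[nu]_x x%:E)%E = mu%:E.

Let D : set (measurableTypeR R) := `[0%R : R, 1%R : R]%classic.
Let mD : measurable D. Proof. exact: measurable_itv. Qed.
Let nuCD : nu (~` D) = 0%E.
Proof. by rewrite probability_setC// nu01 subee. Qed.
Let iD : nu.-integrable D (EFin \o (@id R)).
Proof.
apply: measurable_bounded_integrable => //=.
  by rewrite nu01 ltry.

exists 1; split => // M M1 x; rewrite /D /= in_itv/= => /andP[x0 x1].
by rewrite ger0_norm// (le_trans x1)// ltW.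
Qed.
Let integralD_id : (\int[nu]_(x in D) x%:E)%E = mu%:E.
Proof.
rewrite -nu_mean [RHS](negligible_integral (measurableC mD))//.
  by rewrite setTD setCK.
apply/(negligible_integrable (measurableC mD)) => //; last first.
by rewrite setTD setCK.
Qed.

Lemma unit_interval_mean : 0 <= mu <= 1.
Proof.
rewrite -!lee_fin -integralD_id; apply/andP; split.
  by apply: integral_ge0 => x; rewrite /D /= in_itv/= lee_fin => /andP[].
rewrite -nu01 -[leRHS]mul1e -integral_cst//.
apply: ge0_le_integral => //=.
- by move=> x; rewrite /D /= in_itv/= lee_fin => /andP[].
- by move=> x; rewrite /D /= in_itv/= lee_fin => /andP[].
Qed.

(** On [0,1] convexity puts the exponential below its chord. The mean of the chord depends on the
    law only through [mu], so the Bernoulli law of mean [mu] is the worst case. *)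
Lemma hoeffding_mgf (l : R) :
  (\int[nu]_x (expR (l * (x - mu)))%:E <= (expR (l ^+ 2 / 8))%:E)%E.
Proof.
have mexp : measurable_fun setT (fun x : R => expR (l * (x - mu))).
  apply: measurableT_comp => //; apply: measurable_funM => //.
  exact: measurable_funB.
rewrite (ge0_negligible_integral (measurableC mD))//; last first.
  exact/measurable_EFinP.
rewrite setTD setCK.
pose c := expR (- (l * mu)).
apply: (@le_trans _ _ (\int[nu]_(x in D) (c + c * (expR l - 1) * x)%:E)%E).
  apply: ge0_le_integral => //.
  - by apply/measurable_EFinP; apply: measurable_funTS.
  - by apply/measurable_EFinP; apply: measurable_funTS; apply: measurable_funD.
  - move=> x; rewrite /D /= in_itv/= lee_fin => x01.
    have -> : l * (x - mu) = - (l * mu) + l * x by ring.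
    rewrite expRD -mulrA -[X in X + _]mulr1 -mulrDr ler_pM2l ?expR_gt0//.
    exact: expR_chord.
under eq_integral do rewrite EFinD EFinM.
rewrite integralD//=; last 2 first.
- exact: finite_measure_integrable_cst.
- exact: (integrableZl mD).
rewrite integral_cst// integralZl// integralD_id [X in (_ * X)%E]nu01.
rewrite mule1 -EFinM -EFinD lee_fin.
have -> : c + c * (expR l - 1) * mu =
    expR (- (l * mu)) * (1 - mu + mu * expR l).
  by rewrite /c; ring.
have /(ler_wpM2l (expR_ge0 (- (l * mu)))) :=
  bernoulli_mgf_le l unit_interval_mean.
move=> /le_trans; apply.
by rewrite -expRD addrC addrK.
Qed.
End unit_interval_law.

(** * Separating the past from the next reward under the integral *)

Definition measurable_wrt (R : realType) d (Omega : measurableType d)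
    (F : set (set Omega)) (g : Omega -> R) : Prop :=
  @measurable_fun _ _ (g_sigma_algebraType F) R setT g.

(** Within [H] the reward is independent of the past [F]. The hypothesis says so on rectangles;
    uniqueness of product measures extends it to the joint law, and Tonelli's theorem then separates
    the two factors. *)
Lemma integral_past_mul_reward d (Omega : measurableType d) (R : realType)
    (P : probability Omega R) (F : set (set Omega)) (X : Omega -> R)
    (nu : probability (measurableTypeR R) R) (H : set Omega)
    (g : Omega -> R) (f : R -> R) :
  sigma_algebra setT F -> F `<=` measurable ->
  F H -> measurable_fun setT X ->
  (forall E D, F E -> measurable D ->
     P (E `&` H `&` X @^-1` D) = (P (E `&` H) * nu D)%E) ->
  measurable_wrt F g -> (forall w, 0 <= g w) ->
  measurable_fun setT f -> (forall x, 0 <= f x) ->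
  (\int[P]_(w in H) (g w * f (X w))%:E
   = \int[P]_(w in H) (g w)%:E * \int[nu]_x (f x)%:E)%E.
Proof.
move=> sF FM FH mX indep mg g0 mf f0.
have mFE : F.-sigma.-measurable = F by exact: sigma_algebra_id.
have mH : measurable H by exact: FM.
have PH1 : (mrestr P mH setT <= 1)%E.
  by rewrite /mrestr setTI; exact: probability_le1.
(* Restricted to [H], [P] has mass at most 1, hence the packing as a subprobability, which
   [giry_map] expects. *)
pose PH : giry Omega R :=
  HB.pack (mrestr P mH)
    (Measure_isSubProbability.Build _ _ _ (mrestr P mH) PH1).
(* The identity, from Omega with all its events to Omega with the events of [F]; pushing forward
   along it restricts a measure to the past. *)
pose i : Omega -> g_sigma_algebraType F := id.
have mi : measurable_fun setT i.
  by move=> _ Y mY; rewrite setTI; apply: FM; rewrite -[X in X _]mFE.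
pose j : Omega -> (g_sigma_algebraType F * measurableTypeR R)%type :=
  fun w => (i w, X w).
have mj : measurable_fun setT j by exact/measurable_fun_pairP.
pose m1 := giry_map mi PH.
pose m2 := giry_map mj PH.
(* The joint law of the past and the reward on [H] is a product measure. *)
have prodE B : measurable B -> (m1 \x nu)%E B = m2 B.
  apply: product_measure_unique => E D mE mD.
  have FE : F E by rewrite -[X in X _]mFE.
  have m2E : m2 (E `*` D) = P ((j @^-1` (E `*` D)) `&` H) by [].
  transitivity (P (E `&` H `&` X @^-1` D)); last exact: indep.
  rewrite [LHS]m2E; congr (P _).
  by apply/seteqP; split => w [[? ?] ?].
have restrE (h : Omega -> \bar R) :
    measurable_fun setT h -> (forall w, 0 <= h w)%E ->
    (\int[P]_(w in H) h w = \int[PH]_w h w)%E.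
  move=> mh h0; rewrite [RHS](ge0_negligible_integral (measurableC mH))//.
    rewrite setTD setCK; apply: eq_measure_integral => B mB BH.
    by rewrite /PH /= /mrestr setIidl.
  by rewrite /PH /= /mrestr setICl measure0.
have mEg : measurable_fun setT (g : g_sigma_algebraType F -> R) by exact: mg.
have mgO : measurable_fun setT g.
  have -> : g = (g : g_sigma_algebraType F -> R) \o i by [].
  exact: measurableT_comp mEg mi.
pose h z : \bar R := (g z.1 * f z.2)%:E.
have mh : measurable_fun [set: g_sigma_algebraType F * measurableTypeR R] h.
  apply/measurable_EFinP; apply: measurable_funM => //.
    exact: measurableT_comp mEg measurable_fst.
  exact: measurableT_comp mf measurable_snd.
have h0 z : (0 <= h z)%E by rewrite lee_fin mulr_ge0.
have mEf : measurable_fun setT (EFin \o f) by exact/measurable_EFinP.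
have mEg' : measurable_fun setT (EFin \o (g : g_sigma_algebraType F -> R)).
  exact/measurable_EFinP.
have Ef0 x : (0 <= (EFin \o f) x)%E by rewrite lee_fin.
have Eg0 x : (0 <= (EFin \o g) x)%E by rewrite lee_fin.
rewrite restrE; last 2 first.
- apply/measurable_EFinP; apply: measurable_funM => //.
  exact: measurableT_comp.
- by move=> w; rewrite lee_fin mulr_ge0.
transitivity (\int[m2]_z h z)%E.
  by rewrite [RHS](giry_int_map mj PH mh h0).
transitivity (\int[m1 \x nu]_z h z)%E.
  by apply: eq_measure_integral => B mB _; rewrite [LHS](esym (prodE _ mB)).
rewrite fubini_tonelli1// /fubini_F.
transitivity (\int[m1]_w ((g w)%:E * \int[nu]_x (f x)%:E))%E.
  apply: eq_integral => w _.
  by rewrite -ge0_integralZl ?lee_fin// => x _; rewrite lee_fin.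
transitivity (\int[m1]_w (g w)%:E * \int[nu]_x (f x)%:E)%E.
  apply: ge0_integralZr => //; first by move=> w _; rewrite lee_fin.
  by apply: integral_ge0 => x _; rewrite lee_fin.
congr (_ * _)%E; rewrite restrE; last 2 first.
- exact/measurable_EFinP.
- by move=> w; rewrite lee_fin.
by rewrite [LHS](giry_int_map mi PH mEg' Eg0).
Qed.

Lemma measurable_wrtS (R : realType) d (Omega : measurableType d)
    (F G : set (set Omega)) (g : Omega -> R) :
  F `<=` G ->
  measurable_wrt F g -> measurable_wrt G g.
Proof.
move=> FG mg _ Y mY; have := mg measurableT Y mY.
move: (g @^-1` Y) => Z; rewrite setTI; apply: (sub_smallest2r _ FG).
exact: smallest_sigma_algebra.
Qed.

Lemma measurable_wrtW (R : realType) d (Omega : measurableType d)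
    (F : set (set Omega)) (g : Omega -> R) :
  F `<=` measurable -> measurable_wrt F g -> measurable_fun setT g.
Proof.
move=> FM mg _ Y mY; have := mg measurableT Y mY.
move: (g @^-1` Y) => Z; rewrite setTI; apply: (smallest_sub _ FM).
exact: sigma_algebra_measurable.
Qed.

Lemma integral_partition d (Omega : measurableType d) (R : realType)
    (P : probability Omega R) (K : nat) (Y : Omega -> 'I_K)
    (h : Omega -> \bar R) :
  (forall a, measurable (Y @^-1` [set a])) ->
  measurable_fun setT h -> (forall w, (0 <= h w)%E) ->
  (\int[P]_w h w = \sum_(a < K) \int[P]_(w in Y @^-1` [set a]) h w)%E.
Proof.
move=> mY mh h0.
rewrite -(@ge0_integral_bigsetU _ _ _ P _ (fun a => Y @^-1` [set a]))//.
- congr (integral _ _ _); apply/seteqP; split => // w _.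
  by rewrite -bigcup_seq; exists (Y w) => //=; rewrite mem_index_enum.
- exact: index_enum_uniq.
- apply/trivIsetP => a b _ _ /eqP ab; apply/seteqP.
  by split => // w [/= wa wb]; case: ab; rewrite -wa.
- by apply: measurable_funTS.
Qed.

(** * The exponential supermartingale of an outcome *)

Section supermartingale.
Context (R : realType) (K m : nat) (B : bandit R K m).
Context (Omega : Type) (A : nat -> Omega -> 'I_K) (X : nat -> Omega -> R).

Definition npulls (o : 'I_m) (t : nat) (w : Omega) : nat :=
  \sum_(1 <= s < t.+1) (outcome B (A s w) == o).

Definition reward_sum (o : 'I_m) (t : nat) (w : Omega) : R :=
  \sum_(1 <= s < t.+1) X s w *+ (outcome B (A s w) == o).

(* The compensator is [l^2/8], Hoeffding's constant for rewards in [0,1]: with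
   the constant 1 of [law_sub_gaussian], the bonus [sqrt(2 log t / n)] would be
   too small for the union bound over pull counts. *)
Definition exp_dev (l : R) (o : 'I_m) (t : nat) (w : Omega) : R :=
  expR (l * (reward_sum o t w - mean_reward B o *+ npulls o t w)
        - l ^+ 2 / 8 *+ npulls o t w).

Definition exp_incr (l : R) (o : 'I_m) (a : 'I_K) (x : R) : R :=
  if outcome B a == o then expR (l * (x - mean_reward B o) - l ^+ 2 / 8) else 1.

Lemma npulls0 o w : npulls o 0 w = 0%N.
Proof. by rewrite /npulls big_geq. Qed.

Lemma npullsS o t w :
  npulls o t.+1 w = (npulls o t w + (outcome B (A t.+1 w) == o))%N.
Proof. by rewrite /npulls big_nat_recr. Qed.

Lemma reward_sum0 o w : reward_sum o 0 w = 0.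
Proof. by rewrite /reward_sum big_geq. Qed.

Lemma reward_sumS o t w : reward_sum o t.+1 w =
  reward_sum o t w + X t.+1 w *+ (outcome B (A t.+1 w) == o).
Proof. by rewrite /reward_sum big_nat_recr. Qed.

Lemma exp_dev0 l o w : exp_dev l o 0 w = 1.
Proof. by rewrite /exp_dev npulls0 reward_sum0 !mulr0n !subr0 mulr0 expR0. Qed.

Lemma exp_devS l o t w : exp_dev l o t.+1 w =
  exp_dev l o t w * exp_incr l o (A t.+1 w) (X t.+1 w).
Proof.
rewrite /exp_dev /exp_incr npullsS reward_sumS; case: eqP => _ /=.
  by rewrite -expRD addn1 !mulrS; congr expR; ring.
by rewrite addn0 addr0 mulr1.
Qed.

End supermartingale.

Lemma measurable_exp_incr (R : realType) (K m : nat) (B : bandit R K m)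
  (l : R) (o : 'I_m) (a : 'I_K) : measurable_fun setT (exp_incr B l o a).
Proof.
rewrite /exp_incr; case: eqP => _ //=; apply: measurableT_comp => //.
apply: measurable_funB => //; apply: measurable_funM => //.
exact: measurable_funB.
Qed.

(** On a pull of [o] the compensator cancels the bound of [hoeffding_mgf]; on any other pull the
    factor is constantly 1. *)
Lemma integral_exp_incr (R : realType) (K m : nat) (B : bandit R K m)
    (l : R) (o : 'I_m) (a : 'I_K) :
  (\int[law B (outcome B a)]_x (exp_incr B l o a x)%:E <= 1)%E.
Proof.
rewrite /exp_incr; case: eqP => [<-|_].
  under eq_integral do rewrite expRD EFinM.
  rewrite ge0_integralZr//; last first.
    apply/measurable_EFinP; apply: measurableT_comp => //.
    by apply: measurable_funM => //; apply: measurable_funB.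
  rewrite expRN lee_pdivrMr ?expR_gt0// mul1e.
  exact: hoeffding_mgf (law_unit _ _) (law_mean _ _) _.
by rewrite integral_cst// mul1e; exact: probability_le1.
Qed.

Section interaction_martingale.
Context (R : realType) (K m : nat) (B : bandit R K m).
Context dS (S : measurableType dS) (Q : probability S R).
Context (pick : S -> seq (observation R K m) -> 'I_K) (T : nat).
Context d (Omega : measurableType d) (P : probability Omega R).
Context (F : nat -> set (set Omega)) (seed : Omega -> S).
Context (A : nat -> Omega -> 'I_K) (X : nat -> Omega -> R).
Hypothesis inter : interaction Q pick B T P F seed A X.

Lemma measurable_arm t (h : 'I_K -> R) : (t < T)%N ->
  measurable_wrt (F t) (fun w => h (A t.+1 w)).
Proof.
move=> tT; have [_ _ _ _ arm _ _] := inter.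
(* A function of the next arm is a finite combination of indicators of events of [F t]. *)
have -> : (fun w => h (A t.+1 w)) =
    (fun w => \sum_(a < K) h a * \1_(A t.+1 @^-1` [set a]) w).
  apply/funext => w; rewrite (bigD1 (A t.+1 w)) //= indicE mem_set// mulr1.
  rewrite big1 ?addr0// => a /eqP aA.
  by rewrite indicE memNset ?mulr0// => /= wa; apply: aA.
rewrite /measurable_wrt; apply: measurable_sum => a.
apply: measurable_funM => //; apply: measurable_indic.
by apply: sub_gen_smallest; exact: arm.
Qed.

Lemma measurable_exp_dev l o t : (t <= T)%N ->
  measurable_wrt (F t) (exp_dev B A X l o t).
Proof.
have [[sF FM FS] _ _ _ arm rew _] := inter.
elim: t => [_|t IH tT].
  have -> : exp_dev B A X l o 0%N = cst 1 by apply/funext => w; exact: exp_dev0.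
  exact: measurable_cst.
have -> : exp_dev B A X l o t.+1 = (fun w => exp_dev B A X l o t w *
    \sum_(a < K) exp_incr B l o a (X t.+1 w) * \1_(A t.+1 @^-1` [set a]) w).
  apply/funext => w; rewrite exp_devS (bigD1 (A t.+1 w)) //= indicE.
  rewrite mem_set// mulr1 big1 ?addr0// => a /eqP aA.
  by rewrite indicE memNset ?mulr0// => /= wa; apply: aA.
apply: measurable_funM.
  by apply: measurable_wrtS (FS t) _; exact: IH (ltnW tT).
rewrite /measurable_wrt; apply: measurable_sum => a.
apply: measurable_funM; last first.
  by apply: measurable_indic; apply: sub_gen_smallest; apply: FS; exact: arm.
apply: (measurableT_comp (@measurable_exp_incr _ _ _ B l o a)).
by move=> _ Y mY; rewrite setTI; apply: sub_gen_smallest; exact: rew.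
Qed.

(** Induction on the rounds. Where the next arm is fixed, [exp_dev] is a weight known from the past
    times a function of the new reward, and the latter has mean at most 1. *)
Lemma integral_exp_dev l o t : (t <= T)%N ->
  (\int[P]_w (exp_dev B A X l o t w)%:E <= 1)%E.
Proof.
have [[sF FM FS] _ _ _ arm rew lawX] := inter.
elim: t => [_|t IH tT].
  under eq_integral do rewrite exp_dev0.
  by rewrite integral_cst// mul1e probability_le1.
apply: le_trans (IH (ltnW tT)).
have mA a : measurable (A t.+1 @^-1` [set a]) by apply: (FM t); exact: arm.
have mdev s : (s <= T)%N ->
    measurable_fun setT (fun w => (exp_dev B A X l o s w)%:E).
  move=> sT; apply/measurable_EFinP.
  by apply: measurable_wrtW (FM s) _; exact: measurable_exp_dev.
have dev0 s w : (0 <= (exp_dev B A X l o s w)%:E)%E by rewrite lee_fin expR_ge0.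
rewrite (integral_partition P mA (mdev _ tT) (dev0 _)).
rewrite (integral_partition P mA (mdev _ (ltnW tT)) (dev0 _)).
apply: lee_sum => a _.
under eq_integral => w.
  rewrite inE /= => wa; rewrite exp_devS wa; over.
rewrite (integral_past_mul_reward (nu := law B (outcome B a)) (sF t) (FM t))//.
- rewrite -[leRHS]mule1; apply: lee_wpmul2l; last exact: integral_exp_incr.
  by apply: integral_ge0 => w _; exact: dev0.
- exact: arm.
- by move=> _ Y mY; rewrite setTI; apply: (FM t.+1); exact: rew.
- by move=> E D FE mD; exact: lawX.
- exact: measurable_exp_dev (ltnW tT).
- by move=> w; exact: expR_ge0.
- exact: measurable_exp_incr.
- by move=> x; rewrite /exp_incr; case: ifP => _; rewrite ?expR_ge0.
Qed.

End interaction_martingale.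

(** * Invariants of the algorithm along one trajectory *)

Section pathwise.
Context (R : realType) (K m : nat) (B : bandit R K m) (Omega : Type).
Context (A : nat -> Omega -> 'I_K) (X : nat -> Omega -> R).
Context (T : nat) (st : nat -> Omega -> ucb_state R K m) (w : Omega).
Hypothesis run : pa_ucb_run B T A X st.

Local Notation N o t := (npulls B A o t w).

(** The mean is multiplied by the count so that outcomes never pulled need no exception. The pool
    clause is what makes every fresh probe reveal a new outcome. *)
Record tracks (t : nat) (s : ucb_state R K m) : Prop := Tracks {
  tracks_pulls : forall o, pulls s o = N o t;
  tracks_mean : forall o, emp_mean s o * (N o t)%:R = reward_sum B A X o t w;
  tracks_discovered : forall o, (o \in discovered s) = (0 < N o t)%N;
  tracks_rep : forall o a, rep s o = Some a -> outcome B a = o;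
  tracks_pool : forall a, a \in pool s -> outcome B a \notin discovered s
}.

Lemma tracks_record t s o : tracks t s -> outcome B (A t.+1 w) = o ->
  o \in discovered s -> tracks t.+1 (record_reward s o (X t.+1 w)).
Proof.
case=> Hp Hm Hd Hr Hl Ao od; split => //=.
- move=> o'; rewrite npullsS Ao Hp eq_sym.
  by case: eqP => [<-|_]; rewrite ?addn1 ?addn0 ?Hp.
- move=> o'; rewrite npullsS reward_sumS Ao -(Hm o').
  rewrite [in LHS]eq_sym; case: eqP => [<-|_]; last first.
    by rewrite addn0 mulr0n addr0.
  (* Running mean: (e + (x - e) / (n + 1)) (n + 1) = n e + x. *)
  rewrite Hp addn1 mulr1n mulrDl divfK ?pnatr_eq0//.
  by rewrite -natr1; ring.
- move=> o'; rewrite Hd npullsS Ao; case: eqP => [<-|_]; last by rewrite addn0.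
  by rewrite -Hd od addn1.
Qed.

(** A pool arm has an undiscovered outcome, so [discover] takes its second branch and the previous
    count of that outcome is 0. *)
Lemma tracks_new t s : tracks t s -> A t.+1 w \in pool s ->
  tracks t.+1 (discover s (observe B (A t.+1 w) (X t.+1 w))).
Proof.
case=> Hp Hm Hd Hr Hl Ap; rewrite /discover /= (negbTE (Hl _ Ap)).
have N0 : N (outcome B (A t.+1 w)) t = 0%N.
  by apply/eqP; rewrite -leqn0 leqNgt -Hd Hl.
split => //=.
- move=> o'; rewrite npullsS eq_sym.
  by case: eqP => [<-|_]; rewrite ?N0 ?addn1 ?addn0 ?Hp.
- move=> o'; rewrite npullsS reward_sumS -(Hm o') [in LHS]eq_sym.
  case: eqP => [<-|_]; last by rewrite addn0 mulr0n addr0.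
  by rewrite N0 add0n mulr1 mulr0 add0r.
- move=> o'; rewrite !inE npullsS Hd eq_sym; case: eqP => _ /=.
    by rewrite addn1.
  by rewrite addn0.
- move=> o' a; case: eqP => [-> [<-]//|_]; exact: Hr.
- move=> a; rewrite !inE => /andP[aA /Hl].
  by rewrite (negbTE aA).
Qed.

Lemma tracks_run t : (t <= T)%N -> tracks t (st t w).
Proof.
have [st0 stS] := run w.
elim: t => [_|t IH tT].
  rewrite st0; split => //=.
  - by move=> o; rewrite npulls0.
  - by move=> o; rewrite npulls0 reward_sum0 mulr0.
  - by move=> o; rewrite inE npulls0.
  - by move=> a _; rewrite inE.
have tr := IH (ltnW tT); have := stS t tT.
case=> [_ Ap|o _ od _ ro]; first exact: tracks_new.
by apply: tracks_record => //; exact: tracks_rep tr _ _ ro.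
Qed.

Lemma sum_npulls t : (\sum_(o < m) N o t = t)%N.
Proof.
elim: t => [|t IH]; first by rewrite big1// => o _; rewrite npulls0.
under eq_bigr do rewrite npullsS.
rewrite big_split /= IH (bigD1 (outcome B (A t.+1 w)))//= eqxx.
rewrite big1 ?addn0 ?addn1//.
by move=> o /negbTE; rewrite eq_sym => ->.
Qed.

Lemma npulls_le o t : (N o t <= t)%N.
Proof. by rewrite -[leqRHS](sum_npulls t) (bigD1 o)//= leq_addr. Qed.

End pathwise.

(** * Bounds on means and on square roots *)

Lemma mean_reward01 (R : realType) (K m : nat) (B : bandit R K m) o :
  0 <= mean_reward B o <= 1.
Proof. exact: unit_interval_mean (law_unit B o) (law_mean B o). Qed.

Lemma best_mean_ge (R : realType) (K m : nat) (B : bandit R K m) o :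
  mean_reward B o <= best_mean B.
Proof. exact: le_bigmax. Qed.

Lemma best_mean_le (R : realType) (K m : nat) (B : bandit R K m) (c : R) :
  0 <= c -> (forall o, mean_reward B o <= c) -> best_mean B <= c.
Proof. by move=> c0 mc; apply/bigmax_leP; split. Qed.

(** With x and y the roots of n and n + 1, (y - x) (y + x) = 1, and y <= 2 x as n >= 1; hence 1 <= 3
    x (y - x). *)
Lemma inv_sqrt_le_diff (R : realType) (n : nat) : (0 < n)%N ->
  (Num.sqrt (n%:R : R))^-1 <= 3 * (Num.sqrt n.+1%:R - Num.sqrt n%:R).
Proof.
move=> n0; set x := Num.sqrt n%:R; set y := Num.sqrt n.+1%:R.
have x0 : 0 < x by rewrite sqrtr_gt0 ltr0n.
have xx : x * x = n%:R by rewrite -expr2 sqr_sqrtr.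
have yy : y * y = n%:R + 1 by rewrite -expr2 sqr_sqrtr// -natr1.
have n1 : 1 <= n%:R :> R by rewrite ler1n.
have y0 : 0 <= y by exact: sqrtr_ge0.
have y2 : y <= 2 * x by nra.
have xy : x <= y by rewrite ler_wsqrtr// ler_nat.
rewrite -(ler_pM2r x0) mulVf ?gt_eqF//.
have : (y - x) * (y + x) = 1 by rewrite -[RHS](addrK (x * x) 1); lra.
by nra.
Qed.

Lemma sqrt_quotient_ln_le (R : realType) (t T n : nat) : (0 < t <= T)%N ->
  Num.sqrt (2 * ln t%:R / n%:R) <=
    Num.sqrt (2 * ln T%:R) * (Num.sqrt (n%:R : R))^-1.
Proof.
move=> /andP[t0 tT].
have lt0 : 0 <= ln (t%:R : R) by rewrite ln_ge0// ler1n.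
have ltT : ln (t%:R : R) <= ln T%:R.
  by rewrite ler_ln ?posrE ?ltr0n// ?ler_nat// (leq_trans t0).
rewrite -sqrtrV// -sqrtrM; last by rewrite mulr_ge0// (le_trans lt0).
apply: ler_wsqrtr; rewrite ler_wpM2r ?invr_ge0//.
by rewrite ler_wpM2l.
Qed.

(** * Confidence intervals *)

Section step.
Context (R : realType) (K m : nat) (B : bandit R K m) (Omega : Type).
Context (A : nat -> Omega -> 'I_K) (X : nat -> Omega -> R).

(** Agrees with the bonus in [ucb_index] for positive counts, where the maximum with 1
    disappears. *)
Definition bonus (t n : nat) : R := Num.sqrt (2 * ln t%:R / n%:R).

(* Stands for the indicator that some confidence interval fails at round [t+1]:
   each failure makes one of the summands at least 1, by the Chernoff weight at
   the optimal parameter [4 * bonus]. *)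
Definition overflow (t : nat) (w : Omega) : R :=
  \sum_(o < m) \sum_(1 <= n < t.+1)
    (exp_dev B A X (4 * bonus t.+1 n) o t w
     + exp_dev B A X (- (4 * bonus t.+1 n)) o t w) / t.+1%:R ^+ 4.

Definition sqrt_pulls (t : nat) (w : Omega) : R :=
  \sum_(o < m) Num.sqrt (npulls B A o t w)%:R.

Lemma overflow_term_ge0 t o n w :
  0 <= (exp_dev B A X (4 * bonus t.+1 n) o t w
        + exp_dev B A X (- (4 * bonus t.+1 n)) o t w) / t.+1%:R ^+ 4.
Proof. by rewrite divr_ge0// addr_ge0// expR_ge0. Qed.

Lemma overflow_ge0 t w : 0 <= overflow t w.
Proof.
by apply: sumr_ge0 => o _; apply: sumr_ge0 => n _; exact: overflow_term_ge0.
Qed.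

(** A deviation beyond the bonus b, in the direction of l = 4 b or - 4 b, makes the exponent of
    [exp_dev] at least 4 b^2 n - 2 b^2 n = 4 ln (t + 1), so the matching summand of [overflow]
    reaches 1. *)
Lemma confidence t w o (e : R) :
  overflow t w < 1 -> (0 < npulls B A o t w)%N ->
  e * (npulls B A o t w)%:R = reward_sum B A X o t w ->
  `|e - mean_reward B o| <= bonus t.+1 (npulls B A o t w).
Proof.
set n := npulls B A o t w => G1 n0 eS.
set b := bonus t.+1 n.
have b0 : 0 <= b by exact: sqrtr_ge0.
have nR0 : 0 < n%:R :> R by rewrite ltr0n.
have bb : b ^+ 2 * n%:R = 2 * ln t.+1%:R.
  by rewrite sqr_sqrtr ?divfK ?gt_eqF// divr_ge0// mulr_ge0// ln_ge0// ler1n.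
have nt : (n <= t)%N by exact: npulls_le.
(* The actual count is random but lies between 1 and t, so its summand is among those of [overflow],
   all nonnegative. *)
have term : (exp_dev B A X (4 * b) o t w + exp_dev B A X (- (4 * b)) o t w)
            / t.+1%:R ^+ 4 < 1.
  apply: le_lt_trans G1; rewrite /overflow (bigD1 o)//= -[leLHS]addr0.
  apply: lerD; last first.
    apply: sumr_ge0 => o' _; apply: sumr_ge0 => k _.
    exact: overflow_term_ge0.
  rewrite (bigD1_seq n) ?iota_uniq ?mem_index_iota ?n0 ?ltnS//= -[leLHS]addr0.
  by apply: lerD => //; apply: sumr_ge0 => k _; exact: overflow_term_ge0.
have key l : exp_dev B A X l o t w < t.+1%:R ^+ 4 ->
    l * (e - mean_reward B o) * n%:R - l ^+ 2 / 8 * n%:R < 4 * ln t.+1%:R.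
  rewrite -(@lnK _ (t.+1%:R ^+ 4)) ?posrE ?exprn_gt0// ltr_expR lnXn//.
  rewrite -eS -[mean_reward _ _ *+ _]mulr_natr -[_ / 8 *+ _]mulr_natr.
  by rewrite -[ln _ *+ 4]mulr_natl; apply: le_lt_trans; lra.
rewrite ltr_pdivrMr ?exprn_gt0// mul1r in term.
have dev_gt0 l : 0 < exp_dev B A X l o t w by exact: expR_gt0.
have k1 := key (4 * b) ltac:(have := dev_gt0 (- (4 * b)); lra).
have k2 := key (- (4 * b)) ltac:(have := dev_gt0 (4 * b); lra).
rewrite ler_norml; apply/andP; split; rewrite leNgt; apply/negP => hx; nra.
Qed.

End step.

(** * Regret along one trajectory *)

Section regret_path.
Context (R : realType) (K m : nat) (B : bandit R K m) (Omega : Type).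
Context (A : nat -> Omega -> 'I_K) (X : nat -> Omega -> R).
Context (T : nat) (st : nat -> Omega -> ucb_state R K m) (w : Omega).
Hypothesis run : pa_ucb_run B T A X st.

Let gap t := best_mean B - mean_reward B (outcome B (A t w)).
Let found t : R := #|discovered (st t w)|%:R.

Lemma gap_le1 a : best_mean B - mean_reward B (outcome B a) <= 1.
Proof.
rewrite lerBlDr (@best_mean_le _ _ _ _ _)//.
  by rewrite addr_ge0//; case/andP: (mean_reward01 B (outcome B a)).
move=> o; have /andP[m0 _] := mean_reward01 B (outcome B a).
by have /andP[_ m1] := mean_reward01 B o; rewrite (le_trans m1)// lerDl.
Qed.

Lemma sqrt_pullsS t : sqrt_pulls B A t.+1 w - sqrt_pulls B A t w =
  Num.sqrt (npulls B A (outcome B (A t.+1 w)) t w).+1%:R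
  - Num.sqrt (npulls B A (outcome B (A t.+1 w)) t w)%:R.
Proof.
rewrite /sqrt_pulls -sumrB (bigD1 (outcome B (A t.+1 w)))//= npullsS eqxx addn1.
rewrite big1 ?addr0// => o; rewrite eq_sym npullsS => /negbTE->.
by rewrite addn0 subrr.
Qed.

Lemma sqrt_pulls_ndecr t : 0 <= sqrt_pulls B A t.+1 w - sqrt_pulls B A t w.
Proof. by rewrite sqrt_pullsS subr_ge0 ler_wsqrtr// ler_nat. Qed.

(** Each round is paid for by one term: a discovery by the increment of [found], a failed confidence
    interval by [overflow], and any other round by the increment of the potential, through
    optimism. *)
Lemma gap_step t : (t < T)%N ->
  gap t.+1 <= (found t.+1 - found t)
    + 6 * Num.sqrt (2 * ln T%:R) * (sqrt_pulls B A t.+1 w - sqrt_pulls B A t w)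
    + overflow B A X t w.
Proof.
move=> tT.
have pot0 : 0 <= 6 * Num.sqrt (2 * ln (T%:R : R)) *
    (sqrt_pulls B A t.+1 w - sqrt_pulls B A t w).
  by rewrite mulr_ge0// ?sqrt_pulls_ndecr// mulr_ge0.
have G0 := overflow_ge0 B A X t w.
have tr := tracks_run w run (ltnW tT).
have [_ stS] := run w; rewrite /found.
case: (stS t tT) => [_ Ap|o dm od omax ro] /=.
  rewrite /discover /= (negbTE (tracks_pool tr Ap)) /= cardsU1.
  rewrite (tracks_pool tr Ap) natrD addrK.
  rewrite -[leLHS]addr0 -[leRHS]addrA; apply: lerD; first exact: gap_le1.
  exact: addr_ge0.
rewrite subrr add0r.
have Ao : outcome B (A t.+1 w) = o by exact: tracks_rep tr _ _ ro.
have [G1|G1] := ltP (overflow B A X t w) 1; last first.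
  rewrite -[leLHS]add0r; apply: lerD => //.
  exact: le_trans (gap_le1 _) G1.
have full o' : o' \in discovered (st t w).
  suff -> : discovered (st t w) = [set: 'I_m]%SET by rewrite inE.
  by apply/eqP; rewrite eqEcard finset.subsetT cardsT card_ord dm leqnn.
have conf o' : `|emp_mean (st t w) o' - mean_reward B o'|
    <= bonus R t.+1 (npulls B A o' t w).
  apply: confidence G1 _ _; first by rewrite -(tracks_discovered tr) full.
  exact: tracks_mean tr o'.
have idx o' : ucb_index (st t w) t.+1 o' =
    emp_mean (st t w) o' + bonus R t.+1 (npulls B A o' t w).
  rewrite /ucb_index (tracks_pulls tr) (maxn_idPr _)//.
  by rewrite -(tracks_discovered tr) full.
have b0 : 0 <= bonus R t.+1 (npulls B A o t w) by exact: sqrtr_ge0.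
have gap2 : gap t.+1 <= 2 * bonus R t.+1 (npulls B A o t w).
  (* Optimism: the mean of any o' is at most its index, hence at most the index of [o], which is
     within two bonuses of the mean of [o]. Nonnegativity is also required, because of the default 0
     in [best_mean]. *)
  rewrite /gap Ao lerBlDr; apply: best_mean_le.
    rewrite addr_ge0 ?mulr_ge0//.
    by case/andP: (mean_reward01 B o).
  move=> o'; have := omax o' (full o'); rewrite !idx.
  by move: (conf o) (conf o'); rewrite !ler_norml => /andP[? ?] /andP[? ?]; lra.
rewrite -[leLHS]addr0; apply: lerD => //; apply: (le_trans gap2).
rewrite sqrt_pullsS Ao.
have n0 : (0 < npulls B A o t w)%N by rewrite -(tracks_discovered tr) full.
(* Two bonuses and the factor 3 of [inv_sqrt_le_diff] make the constant 6. *)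
have h1 := @sqrt_quotient_ln_le R t.+1 T (npulls B A o t w) tT.
have h2 := @inv_sqrt_le_diff R _ n0.
have h3 := ler_wpM2l (sqrtr_ge0 (2 * ln T%:R)) h2.
rewrite /bonus; lra.
Qed.

Lemma sum_gap_le t : (t <= T)%N ->
  \sum_(0 <= s < t) gap s.+1 <= found t
    + 6 * Num.sqrt (2 * ln T%:R) * sqrt_pulls B A t w
    + \sum_(0 <= s < t) overflow B A X s w.
Proof.
elim: t => [_|t IH tT].
  rewrite !big_geq// addr0 addr_ge0// ?mulr_ge0// /sqrt_pulls.
  by apply: sumr_ge0 => o _.
rewrite !big_nat_recr//=.
have := gap_step tT; have := IH (ltnW tT).
by rewrite mulrBr; lra.
Qed.

(** Cauchy-Schwarz, since the [m] counts sum to [t]. *)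
Lemma sqrt_pulls_le t : sqrt_pulls B A t w <= Num.sqrt (m%:R * t%:R).
Proof.
case: t => [|t].
  rewrite /sqrt_pulls mulr0 sqrtr0 big1// => o _.
  by rewrite npulls0 sqrtr0.
(* The outcome of any arm shows that ['I_m] is inhabited. *)
have m0 : (0 < m)%N by case: (m) (outcome B (A 0%N w)) => [[]|].
set x := Num.sqrt (m%:R : R); set y := Num.sqrt (t.+1%:R : R).
have x0 : 0 < x by rewrite sqrtr_gt0 ltr0n.
have y0 : 0 < y by rewrite sqrtr_gt0 ltr0n.
have xx : x * x = m%:R by rewrite -expr2 sqr_sqrtr.
have yy : y * y = t.+1%:R by rewrite -expr2 sqr_sqrtr.
rewrite sqrtrM// -/x -/y.
(* AM-GM with the weight making both terms sum to [x * y]: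
   [sqrt n <= (n * (x / y) + y / x) / 2] *)
apply: (@le_trans _ _
    (\sum_(o < m) ((npulls B A o t.+1 w)%:R * (x / y) + y / x) / 2)).
  apply: ler_sum => o _; set n := (npulls _ _ _ _ _)%:R.
  have nn : Num.sqrt n * Num.sqrt n = n :> R by rewrite -expr2 sqr_sqrtr.
  have -> : n * (x / y) + y / x = (n * x ^+ 2 + y ^+ 2) / (x * y).
    by field; rewrite !gt_eqF.
  rewrite ler_pdivlMr// ler_pdivlMr ?mulr_gt0// -{2}nn.
  have := sqr_ge0 (Num.sqrt n * x - y); lra.
rewrite -mulr_suml big_split /= -mulr_suml -natr_sum sum_npulls.
rewrite sumr_const card_ord -[_ *+ m]mulr_natr -xx -yy.
by rewrite le_eqVlt; apply/orP; left; apply/eqP; field; rewrite !gt_eqF.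
Qed.

End regret_path.

(** * Expected overflow and expected regret *)

Lemma sum_cube_tail_le1 (R : realType) (T : nat) :
  \sum_(0 <= t < T) t%:R / t.+1%:R ^+ 4 <= 1 :> R.
Proof.
(* Telescoping with 1 / (t + 1) - 1 / (t + 2), which dominates because t (t + 2) <= (t + 1)^3. *)
apply: (@le_trans _ _ (\sum_(0 <= t < T) (- t.+2%:R^-1 - - t.+1%:R^-1))).
  apply: ler_sum => t _; rewrite opprK -!natr1.
  have t0 : 0 <= t%:R :> R by exact: ler0n.
  have -> : - (t%:R + 1 + 1)^-1 + (t%:R + 1)^-1 =
      ((t%:R + 1) ^+ 3 / (t%:R + 1 + 1)) / (t%:R + 1) ^+ 4 :> R.
    have h1 : t%:R + 1 != 0 :> R by rewrite natr1 pnatr_eq0.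
    have h2 : t%:R + 1 + 1 != 0 :> R by rewrite !natr1 pnatr_eq0.
    by field; rewrite h1 h2.
  rewrite ler_pM2r; last by rewrite invr_gt0 exprn_gt0// natr1 ltr0n.
  by rewrite ler_pdivlMr; [nra|rewrite !natr1 ltr0n].
rewrite telescope_sumr// invr1 opprK.
by rewrite gerDr oppr_le0 invr_ge0.
Qed.

Section regret.
Context (R : realType) (K m : nat) (B : bandit R K m).
Context dS (S : measurableType dS) (Q : probability S R).
Context (pick : S -> seq (observation R K m) -> 'I_K) (T : nat).
Context d (Omega : measurableType d) (P : probability Omega R).
Context (F : nat -> set (set Omega)) (seed : Omega -> S).
Context (A : nat -> Omega -> 'I_K) (X : nat -> Omega -> R).
Context (st : nat -> Omega -> ucb_state R K m).
Hypothesis inter : interaction Q pick B T P F seed A X.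
Hypothesis run : pa_ucb_run B T A X st.

Let gap t w := best_mean B - mean_reward B (outcome B (A t w)).

Let gap_ge0 t w : 0 <= gap t w.
Proof. by rewrite subr_ge0 best_mean_ge. Qed.

Let FM t : F t `<=` measurable.
Proof. by have [[_ FM _] _ _ _ _ _ _] := inter; exact: FM. Qed.

Let measurable_gap t : (t < T)%N -> measurable_fun setT (gap t.+1).
Proof.
move=> tT; apply: (measurable_wrtW (@FM t)).
exact: (measurable_arm inter
  (fun a => best_mean B - mean_reward B (outcome B a))).
Qed.

Let measurable_dev l o t : (t <= T)%N ->
  measurable_fun setT (exp_dev B A X l o t).
Proof.
move=> tT; apply: (measurable_wrtW (@FM t)).
exact: (measurable_exp_dev inter _ _ tT).
Qed.

Lemma measurable_overflow t : (t <= T)%N ->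
  measurable_fun setT (overflow B A X t).
Proof.
move=> tT; apply: measurable_sum => o; apply: measurable_sum => n.
by apply: measurable_funM => //; apply: measurable_funD; exact: measurable_dev.
Qed.

(** Union bound: 2 m t weights, each of mean at most 1 and divided by (t + 1)^4. *)
Lemma integral_overflow t : (t <= T)%N ->
  (\int[P]_w (overflow B A X t w)%:E <=
   (2 * m%:R * (t%:R / t.+1%:R ^+ 4))%:E)%E.
Proof.
move=> tT; rewrite /overflow.
under eq_integral do rewrite -sumEFin.
rewrite ge0_integral_sum//; last 2 first.
- move=> o; apply/measurable_EFinP; apply: measurable_sum => n.
  apply: measurable_funM => //.
  by apply: measurable_funD; exact: measurable_dev.
- move=> o w _; rewrite lee_fin; apply: sumr_ge0 => n _.
  exact: overflow_term_ge0.
apply: (@le_trans _ _ (\sum_(o < m) (2 * (t%:R / t.+1%:R ^+ 4))%:E)%E);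
  last first.
  rewrite sumEFin lee_fin sumr_const card_ord le_eqVlt.
  by apply/orP; left; apply/eqP; ring.
apply: lee_sum => o _.
under eq_integral do rewrite -sumEFin.
rewrite ge0_integral_sum//; last 2 first.
- move=> n; apply/measurable_EFinP.
  apply: measurable_funM => //.
  by apply: measurable_funD; exact: measurable_dev.
- by move=> n w _; rewrite lee_fin overflow_term_ge0.
apply: (@le_trans _ _ (\sum_(1 <= n < t.+1) (2 / t.+1%:R ^+ 4)%:E)%E);
  last first.
  rewrite sumEFin lee_fin sumr_const_nat subn1 le_eqVlt.
  by apply/orP; left; apply/eqP; ring.
apply: lee_sum => n _.
under eq_integral do rewrite EFinM EFinD.
have mdev l : measurable_fun setT (fun w => (exp_dev B A X l o t w)%:E).
  by apply/measurable_EFinP; exact: measurable_dev.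
have dev0 l w : setT w -> (0 <= (exp_dev B A X l o t w)%:E)%E.
  by move=> _; rewrite lee_fin expR_ge0.
rewrite ge0_integralZr//; last 2 first.
- by apply: emeasurable_funD; exact: mdev.
- by move=> w _; rewrite adde_ge0 ?dev0.
rewrite EFinM; apply: lee_wpmul2r; first by rewrite lee_fin invr_ge0 exprn_ge0.
rewrite (ge0_integralD _ measurableT (dev0 _) (mdev _) (dev0 _) (mdev _)).
have -> : 2%:E = (1 + 1)%E :> \bar R by rewrite -EFinD.
by apply: leeD; exact: (integral_exp_dev inter _ _ tT).
Qed.

Lemma expected_regretE : expected_regret B P A T =
  (\int[P]_w (\sum_(0 <= t < T) gap t.+1 w)%:E)%E.
Proof.
rewrite /expected_regret big_add1 /= big_mkord.
under [RHS]eq_integral do rewrite big_mkord -sumEFin.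
rewrite ge0_integral_sum//.
- by apply: eq_bigr => t _; rewrite unlock.
- by move=> t; apply/measurable_EFinP; exact: measurable_gap.
- by move=> t w _; rewrite lee_fin gap_ge0.
Qed.

Let measurable_sum_gap :
  measurable_fun setT (fun w => (\sum_(0 <= t < T) gap t.+1 w)%:E).
Proof.
apply/measurable_EFinP; under eq_fun do rewrite big_mkord.
by apply: measurable_sum => t; exact: measurable_gap.
Qed.

Lemma expected_regret_le_horizon : (expected_regret B P A T <= T%:R%:E)%E.
Proof.
rewrite expected_regretE.
have -> : T%:R%:E = (\int[P]_w (cst T%:R%:E) w)%E :> \bar R.
  by rewrite integral_cst// [X in (_ * X)%E]probability_setT mule1.
apply: ge0_le_integral => //.
- by move=> w _; rewrite lee_fin sumr_ge0.
- move=> w _; rewrite lee_fin.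
  apply: (@le_trans _ _ (\sum_(0 <= t < T) 1)).
    by apply: ler_sum => t _; exact: gap_le1.
  by rewrite sumr_const_nat subn0.
Qed.

(** Of the term 3 m, one m pays for the discoveries and 2 m for the expected overflow summed over
    all rounds. *)
Lemma expected_regret_le : (expected_regret B P A T <=
  (3 * m%:R + 6 * Num.sqrt (2 * ln T%:R) * Num.sqrt (m%:R * T%:R))%:E)%E.
Proof.
rewrite expected_regretE.
set c := 6 * Num.sqrt (2 * ln T%:R) * Num.sqrt (m%:R * T%:R).
have c0 : 0 <= c by rewrite !mulr_ge0.
have mover :
    measurable_fun setT (fun w => (\sum_(t < T) overflow B A X t w)%:E).
  apply/measurable_EFinP; apply: measurable_sum => t.
  by apply: measurable_overflow; exact: ltnW.
apply: (@le_trans _ _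
    (\int[P]_w ((m%:R + c)%:E + (\sum_(t < T) overflow B A X t w)%:E))%E).
  apply: ge0_le_integral => //.
  - by move=> w _; rewrite lee_fin sumr_ge0.
  - by apply: emeasurable_funD.
  - move=> w _; rewrite -EFinD lee_fin.
    apply: (le_trans (sum_gap_le w run (leqnn T))).
    rewrite big_mkord lerD2r; apply: lerD.
      by rewrite ler_nat -[leqRHS]card_ord max_card.
    by rewrite ler_wpM2l ?mulr_ge0// sqrt_pulls_le.
rewrite ge0_integralD//; last 2 first.
- by move=> w _; rewrite lee_fin addr_ge0.
- by move=> w _; rewrite lee_fin sumr_ge0// => t _; exact: overflow_ge0.
rewrite integral_cst// [X in (_ * X)%E]probability_setT mule1.
have -> : 3 * m%:R + c = m%:R + c + 2 * m%:R by ring.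
rewrite [leRHS]EFinD; apply: leeD => //.
under eq_integral do rewrite -sumEFin.
rewrite ge0_integral_sum//; last 2 first.
- move=> t; apply/measurable_EFinP.
  by apply: measurable_overflow; exact: ltnW.
- by move=> t w _; rewrite lee_fin overflow_ge0.
apply: (@le_trans _ _
    (\sum_(t < T) (2 * m%:R * (t%:R / t.+1%:R ^+ 4))%:E)%E).
  by apply: lee_sum => t _; apply: integral_overflow; exact: ltnW.
rewrite sumEFin lee_fin -mulr_sumr -[leRHS]mulr1 ler_wpM2l//.
by have := sum_cube_tail_le1 R T; rewrite big_mkord.
Qed.
End regret.

Theorem theorem5 (R : realType) :
  exists2 C : R, 0 < C &
    forall (K m : nat)
      (dS : measure_display) (S : measurableType dS) (Q : probability S R)
      (pick : S -> seq (observation R K m) -> 'I_K)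
      (B : bandit R K m) (T : nat)
      (d : measure_display) (Omega : measurableType d)
      (P : probability Omega R)
      (F : nat -> set (set Omega)) (seed : Omega -> S)
      (A : nat -> Omega -> 'I_K) (X : nat -> Omega -> R)
      (st : nat -> Omega -> ucb_state R K m),
      (2 <= T)%N ->
      interaction Q pick B T P F seed A X ->
      pa_ucb_run B T A X st ->
      (expected_regret B P A T
         <= (C * Num.sqrt (m%:R * T%:R * ln T%:R))%:E)%E.
Proof.
(* Let s be the root of m T ln T. If m <= T, then 3 m <= 3 sqrt(m T) <= 6 s and the main term is at
   most 6 sqrt(2) s <= 12 s, in total 18 s. If T < m, then T <= 2 s. *)
exists 18 => // K m dS S Q pick B T d Omega P F seed A X st T2 inter run.
have lnT : 2^-1 <= ln (T%:R : R).
  apply: (@le_trans _ _ (ln 2)); last first.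
    by rewrite ler_ln ?posrE ?ltr0n ?ler_nat// (leq_trans _ T2).
  (* ln 2 >= 1/2 amounts to e^(-1/2) >= 1/2, which follows from e^x >= 1 + x. *)
  rewrite -ler_expR lnK ?posrE// -[leLHS]invrK -expRN.
  rewrite -[leRHS]invrK lef_pV2 ?posrE ?invr_gt0 ?expR_gt0//.
  by have := @expR_ge1Dx R (- 2^-1); lra.
have sqrt_mT : Num.sqrt (m%:R * T%:R : R) <=
    2 * Num.sqrt (m%:R * T%:R * ln T%:R).
  have -> : 2 = Num.sqrt (4 : R).
    by rewrite (_ : 4 = 2 ^+ 2) ?sqrtr_sqr ?ger0_norm//; ring.
  rewrite -sqrtrM// ler_wsqrtr//.
  have : 0 <= m%:R * T%:R :> R by rewrite mulr_ge0.
  nra.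
have [Tm|mT] := ltnP T m.
  apply: (le_trans (expected_regret_le_horizon inter)).
  rewrite lee_fin.
  have : T%:R <= Num.sqrt (m%:R * T%:R : R).
    rewrite -[leLHS]ger0_norm// -sqrtr_sqr ler_wsqrtr// expr2 ler_wpM2r//.
    by rewrite ler_nat ltnW.
  have := sqrtr_ge0 (m%:R * T%:R * ln T%:R : R); lra.
apply: (le_trans (expected_regret_le inter run)); rewrite lee_fin.
have m_le : m%:R <= Num.sqrt (m%:R * T%:R : R).
  rewrite -[leLHS]ger0_norm// -sqrtr_sqr ler_wsqrtr// expr2 ler_wpM2l//.
  by rewrite ler_nat.
have -> : 6 * Num.sqrt (2 * ln T%:R) * Num.sqrt (m%:R * T%:R) =
    6 * Num.sqrt 2 * Num.sqrt (m%:R * T%:R * ln T%:R) :> R.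
  rewrite -!mulrA -!sqrtrM ?mulr_ge0//; last by lra.
  by congr (_ * Num.sqrt _); ring.
have s2 : Num.sqrt (2 : R) <= 2.
  by rewrite -[leRHS]ger0_norm// -sqrtr_sqr ler_wsqrtr// expr2; lra.
have := sqrtr_ge0 (m%:R * T%:R * ln T%:R : R); nra.
Qed.
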